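(* Let $\{(X_i,\mathcal{F}_i)\}_{i\in I}$ be a family in which each $X_i$ is a non-empty set and $\mathcal{F}_i$ is a filter in $X_i$, and let $\mathcal{F}$ be a filter on $I$. The boxes $\langle F_i\rangle$ such that $\delta\langle F_i\rangle\in\mathcal{F}$ form a base for a filter in $\prod_{i\in I}X_i$.
   Context: A filter in a set $X$ is a non-empty family of non-empty subsets of $X$ closed under finite intersections and supersets; for the filter $\mathcal{F}$ on the index set $I$ the trivial filter $2^I$ (all subsets of $I$) is also allowed. A box in $\prod_{i\in I}X_i$ is a set $\langle F_i\rangle:=\prod_{i\in I}F_i$ with $F_i\in\mathcal{F}_i$ for every $i\in I$. Its set of distinguished indexes is $\delta\langle F_i\rangle:=\{i\in I\mid F_i=X_i\}$. A family $\mathcal{B}\subseteq 2^X$ is a base for a filter in $X$ if $\mathcal{B}\neq\varnothing$, $\varnothing\notin\mathcal{B}$, and for any $B_1,B_2\in\mathcal{B}$ there is $B_3\in\mathcal{B}$ with $B_3\subseteq B_1\cap B_2$. *)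

(* Defs.v *)
From mathcomp Require Import all_boot.
From mathcomp Require Import boolp classical_sets filter.

Set Implicit Arguments.
Unset Strict Implicit.
Unset Printing Implicit Defensive.

Local Open Scope classical_set_scope.

Definition is_filter_base (T : Type) (B : set_system T) : Prop :=
  [/\ B !=set0,
      ~ B set0 &
      forall B1 B2, B B1 -> B B2 -> exists2 B3, B B3 & B3 `<=` B1 `&` B2].

Definition box (I : Type) (X : I -> Type) (A : forall i, set (X i)) :
    set (forall i, X i) :=
  [set x | forall i, A i (x i)].

(* This is a function of the family of sides rather than of the set [box A].
   The two agree as long as all the sides are non-empty, since a non-empty box
   determines its sides. *)
Definition distinguished (I : Type) (X : I -> Type)
    (A : forall i, set (X i)) : set I :=
  [set i | A i = [set: X i]].

Definition filter_boxes (I : Type) (X : I -> Type)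
    (FX : forall i, set_system (X i)) (F : set_system I) :
    set_system (forall i, X i) :=
  [set box A | A in [set A : forall i, set (X i) |
                       (forall i, FX i (A i)) /\ F (distinguished A)]].

(* Main.v *)
Require Import Defs.
From mathcomp Require Import all_boot.
From mathcomp Require Import boolp classical_sets filter.

Local Open Scope classical_set_scope.

(** The family of sides [setT] gives a box that always qualifies, since all its
    indexes are distinguished.  A box in the family is non-empty by the axiom of
    choice, because members of a proper filter are non-empty ([box_neq0]).
    Finally the family is closed under binary intersections: boxes intersect
    side by side ([box_setI]), and an index distinguished for both boxes is
    distinguished for their intersection ([distinguished_setI]), so the set of
    distinguished indexes stays in the filter on the index type. *)

Lemma box_neq0 (I : Type) (X : I -> Type) (A : forall i, set (X i)) :
  (forall i, A i !=set0) -> box A !=set0.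
Proof. by move=> A0; exists (fun i => sval (cid (A0 i))) => i; case: cid. Qed.

Lemma box_setI (I : Type) (X : I -> Type) (A B : forall i, set (X i)) :
  box (fun i => A i `&` B i) = box A `&` box B.
Proof.
apply/seteqP; split=> [x ABx | x [Ax Bx] i]; last by split.
by split=> i; case: (ABx i).
Qed.

Lemma distinguished_setI (I : Type) (X : I -> Type) (A B : forall i, set (X i)) :
  distinguished A `&` distinguished B `<=` distinguished (fun i => A i `&` B i).
Proof. by move=> i [Ai Bi]; rewrite /distinguished /= Ai Bi setTI. Qed.

(* A filter in [X i] is a [ProperFilter].  The filter on [I] is a [Filter],
   which, unlike [ProperFilter], allows the trivial filter of all subsets. *)
Theorem proposition4p1 (I : Type) (X : I -> Type)
    (X_neq0 : forall i, [set: X i] !=set0)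
    (FX : forall i, set_system (X i)) (FX_filter : forall i, ProperFilter (FX i))
    (F : set_system I) (F_filter : Filter F) :
  is_filter_base (filter_boxes FX F).
Proof.
split.
- exists (box (fun i => [set: X i])), (fun i => [set: X i]) => //.
  split=> [i|]; first exact: filterT.
  by apply: filterS filterT => i.
- case=> A [FA _] A0.
  have [|x] := @box_neq0 I X A; last by rewrite A0.
  by move=> i; apply: (@filter_ex _ (FX i)).
- move=> _ _ [A [FA dA] <-] [B [FB dB] <-].
  exists (box (fun i => A i `&` B i)); last by rewrite box_setI.
  exists (fun i => A i `&` B i) => //; split=> [i|]; first exact: filterI.
  by apply: filterS (filterI dA dB); apply: distinguished_setI.
Qed.
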